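(* Let $T$ be a rooted tree that does not consist only of its root, and let $C(T)$ be its ancestral matrix. Then every eigenvalue of $C(T)$ is greater than or equal to $1$. Moreover, the multiplicity of $1$ as an eigenvalue of $C(T)$ equals $$(\text{number of leaves of } T) - (\text{number of non-root vertices of } T \text{ adjacent to a leaf}).$$ A basis of the eigenspace of the eigenvalue $1$ is obtained as follows (vectors are indexed by the leaves of $T$, and $\mathbf{e}_u$ denotes the vector with entry $1$ at leaf $u$ and $0$ elsewhere): for every maximal (with respect to inclusion) set $\{w_1,w_2,\ldots,w_r\}$ of leaves sharing a common parent, take the vectors $\mathbf{e}_{w_1}-\mathbf{e}_{w_j}$ for $j\in\{2,\ldots,r\}$; in addition, if at least one leaf is adjacent to the root, pick one such leaf $u$ and take the vector $\mathbf{e}_u$. The set of all these vectors is a basis of the eigenspace of $1$.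
   Context: A rooted tree $T$ has a distinguished vertex $r$, the root; the level $\ell(v)$ of a vertex $v$ is its distance from $r$. A leaf is a vertex without children (the root counts as a leaf only if it is the only vertex). For vertices $v,w$, $v\vee w$ denotes the common ancestor of $v$ and $w$ farthest from the root (every vertex is considered an ancestor of itself). If $v_1,\ldots,v_n$ are the leaves of $T$, the ancestral matrix $C(T)$ is the $n\times n$ matrix whose $(i,j)$ entry is $\ell(v_i\vee v_j)$; it is symmetric and its spectrum does not depend on the ordering of the leaves. *)

(* Defs.v *)
From HB Require Import structures.
From mathcomp Require Import all_boot all_order all_algebra.
From mathcomp Require Import complex.

Set Implicit Arguments.
Unset Strict Implicit.
Unset Printing Implicit Defensive.

Import GRing.Theory Num.Theory.
Local Open Scope ring_scope.

Record rooted_tree (V : finType) := RootedTree {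
  adj : rel V;
  troot : V;
  adj_sym : symmetric adj;
  adj_irr : irreflexive adj;
  adj_connected : forall x y, connect adj x y;
  adj_acyclic : forall c : seq V, (2 < size c)%N -> ~ ucycle adj c
}.

(* The least length of an e-walk from x to y. A shortest walk visits each
   vertex at most once, so only lengths below #|V| are tried. The value is
   #|V| when y is not reachable, which does not occur in a connected graph. *)
Definition dist (V : finType) (e : rel V) (x y : V) : nat :=
  find (fun k => [exists p : k.-tuple V, path e x p && (last x p == y)])
       (iota 0 #|V|).

Section Tree.
Variables (V : finType) (T : rooted_tree V).

Definition level (v : V) : nat := dist (adj T) (troot T) v.

Definition parent_of : rel V :=
  [rel p v | adj T p v && (level v == (level p).+1)].

Definition leaf (v : V) : bool := [forall w, ~~ parent_of v w].

Definition leaves : {set V} := [set v | leaf v].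

Definition ancestor : rel V := connect parent_of.

Definition lca (v w : V) : V :=
  [arg max_(a > troot T | ancestor a v && ancestor a w) level a]%N.

Definition nonroot_adj_leaf : {set V} :=
  [set p | (p != troot T) && [exists w, leaf w && adj T p w]].

Definition share_parent (B : {set V}) : bool :=
  (B \subset leaves) && [exists p, [forall w in B, parent_of p w]].

Definition sibling_classes : {set {set V}} :=
  [set B : {set V} | maxset share_parent B].

Definition leaf_ordering n (l : 'I_n -> V) : Prop :=
  injective l /\ forall w, (w \in codom l) = (w \in leaves).

Definition ancestral_mx (K : nzRingType) n (l : 'I_n -> V) : 'M[K]_n :=
  \matrix_(i, j) (level (lca (l i) (l j)))%:R.

Definition leaf_vec (K : nzRingType) n (l : 'I_n -> V) (w : V) : 'cV[K]_n :=
  \col_i (l i == w)%:R.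

(* h picks the distinguished leaf w_1 of every class. *)
Definition class_choice (h : {set V} -> V) : Prop :=
  forall B, B \in sibling_classes -> h B \in B.

(* None is allowed only when no leaf is adjacent to the root. *)
Definition root_leaf_choice (ou : option V) : bool :=
  if ou is Some u then leaf u && adj T (troot T) u
  else [forall u, leaf u ==> ~~ adj T (troot T) u].

Definition eigenvectors1 (K : nzRingType) n (l : 'I_n -> V)
    (h : {set V} -> V) (ou : option V) : seq 'cV[K]_n :=
  [seq leaf_vec K l (h B) - leaf_vec K l w
     | B <- enum sibling_classes, w <- enum (B :\ h B)]
  ++ (if ou is Some u then [:: leaf_vec K l u] else [::]).

End Tree.

(* Main.v *)
(** The level of a vertex is the number of its non-root ancestors, so
    [C(T) i j] counts the common non-root ancestors of the leaves [i] and [j].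
    Separating the leaves themselves among these ancestors gives
    [C(T) = 1 + N N^T], with [N] the incidence matrix between leaves and
    non-root inner vertices below which they lie; hence all eigenvalues are at
    least 1, and [C(T) x = x] iff for every non-root inner vertex the
    coordinates of [x] below it sum to 0. Grouping leaves by their parent, this
    triangular system is equivalent to the vanishing, for every non-root
    vertex, of the sum of [x] over its leaf children. These conditions have
    disjoint supports, which gives both the basis and the dimension; the latter
    is the algebraic multiplicity because [C(T)] is symmetric. *)
Require Import Defs.
From mathcomp Require Import all_boot all_order all_algebra complex.

Set Implicit Arguments.
Unset Strict Implicit.
Unset Printing Implicit Defensive.

Import GRing.Theory Num.Theory.

(** * Shortest walks in a finite graph *)

Section Distance.
Context (V : finType) (e : rel V).

Lemma dist_le x y p : path e x p -> last x p = y -> dist e x y <= size p.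
Proof.
(* A walk with at least [#|V|] steps is no shorter than any value the search can return. *)
move=> xp lp; rewrite /dist; case: (ltnP (size p) #|V|) => [lt|ge]; last first.
  by apply: leq_trans ge; rewrite -{2}(size_iota 0 #|V|) find_size.
rewrite leqNgt; apply/negP => /(before_find 0).
rewrite nth_iota // add0n => /existsP[]; exists (in_tuple p).
by rewrite /= xp lp eqxx.
Qed.

Lemma dist_path x y : connect e x y ->
  exists p, [/\ path e x p, last x p = y & size p = dist e x y].
Proof.
move=> /connectP[p0 /shortenP[p xp up _] ly].
have lt : size p < #|V|.
  by have := max_card (mem (x :: p)); rewrite (card_uniqP up).
have : has (fun k => [exists p : k.-tuple V, path e x p && (last x p == y)])
   (iota 0 #|V|).
  apply/hasP; exists (size p); first by rewrite mem_iota.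
  by apply/existsP; exists (in_tuple p); rewrite /= xp ly eqxx.
move=> hk; have := nth_find 0 hk; rewrite nth_iota ?add0n; last first.
  by rewrite -{2}(size_iota 0 #|V|) -has_find.
by move=> /existsP[q /andP[xq /eqP lq]]; exists q; rewrite size_tuple.
Qed.

End Distance.

(** * Levels and parents in a tree *)

Section RootedTree.
Context (V : finType) (T : rooted_tree V).
Implicit Types (x y v w a b : V).
Local Notation r := (troot T).
Local Notation level := (level T).
Local Notation parent_of := (parent_of T).
Local Notation ancestor := (ancestor T).
Local Notation leaf := (leaf T).

Definition off_edge x y : rel V := fun a b =>
  [&& adj T a b, ~~ ((a == x) && (b == y)) & ~~ ((a == y) && (b == x))].

Lemma off_sym x y : connect_sym (off_edge x y).
Proof.
apply: sym_connect_sym => a b; rewrite /off_edge adj_sym.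
by congr (_ && _); rewrite andbC; congr (~~ _ && ~~ _); rewrite andbC.
Qed.

(* A simple path from x to y avoiding the edge {x, y} would close into a
   cycle. *)
Lemma edge_bridge x y : adj T x y -> ~~ connect (off_edge x y) x y.
Proof.
move=> xy; apply/negP => /connectP[p0 /shortenP[p xp up _] ly].
have pxy : path (adj T) x p.
  by apply: sub_path xp => a b /andP[].
case: p => [|b [|c p]] /= in xp up ly pxy *.
- by move: xy; rewrite ly adj_irr.
- by move: xp; rewrite -ly /off_edge !eqxx andbF.
- apply: (@adj_acyclic _ T [:: x, b, c & p]) => //.
  apply/andP; split=> //=; rewrite rcons_path -ly (@adj_sym _ T y) xy andbT.
  exact: pxy.
Qed.

Lemma level_root : level r = 0.
Proof. by apply/eqP; rewrite -leqn0 (@dist_le _ _ _ _ [::]). Qed.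

Lemma level_path v :
  exists p, [/\ path (adj T) r p, last r p = v & size p = level v].
Proof. exact/dist_path/adj_connected. Qed.

Lemma level_eq0 v : (level v == 0) = (v == r).
Proof.
apply/eqP/eqP => [l0|->]; last exact: level_root.
by have [p [_ lp]] := level_path v; rewrite l0 => /size0nil p0; rewrite -lp p0.
Qed.

Lemma level_adj x y : adj T x y -> level y <= (level x).+1.
Proof.
move=> xy; have [p [rp lp <-]] := level_path x.
rewrite -(size_rcons p y); apply: dist_le; last exact: last_rcons.
by rewrite rcons_path rp lp.
Qed.

Lemma parent_exists v : v != r -> exists p, parent_of p v.
Proof.
rewrite -level_eq0; have [p [+ + sp]] := level_path v.
case/lastP: p sp => [<- //|p w]; rewrite rcons_path last_rcons size_rcons.
move=> lv /andP[rp pw] wv _; rewrite {}wv in pw *.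
exists (last r p); rewrite /parent_of /= pw eqn_leq level_adj //= -lv ltnS.
exact: dist_le.
Qed.

Lemma parent_level p v : parent_of p v -> level v = (level p).+1.
Proof. by move=> /andP[_ /eqP]. Qed.

(** Climbing from [u] to the root through parents stays at levels below that of [y], so it never
    meets [y] and cannot use the edge between [x] and [y]. *)
Lemma off_level x y u : level u < level y -> connect (off_edge x y) r u.
Proof.
have [k] := ubnP (level u); elim: k u => // k IHk u; rewrite ltnS => luk luy.
have [->//|/parent_exists[p pu]] := eqVneq u r.
have lp := parent_level pu.
have ltpu : level p < level u by rewrite lp.
apply: connect_trans (IHk p (leq_trans ltpu luk) (ltn_trans ltpu luy)) _.
apply: connect1; have /andP[pu' _] := pu; rewrite /off_edge pu' /=.
have /negPf -> : u != y by apply: contraTneq luy => ->; rewrite ltnn.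
rewrite andbF /=.
have /negPf -> // : p != y.
by apply: contraTneq (ltn_trans ltpu luy) => ->; rewrite ltnn.
Qed.

(** With a second parent [q], the route from [p] up to the root, down to [q] and on to [v] would
    avoid the edge from [p] to [v], which is a bridge. *)
Lemma parent_uniq p q v : parent_of p v -> parent_of q v -> p = q.
Proof.
move=> pv qv; apply/eqP/negPn/negP => neq.
have /andP[apv _] := pv; have /andP[aqv _] := qv.
apply: (negP (edge_bridge apv)).
apply: (@connect_trans _ _ r).
  by rewrite off_sym off_level // (parent_level pv).
apply: (@connect_trans _ _ q).
  by rewrite off_level // (parent_level qv).
apply: connect1; rewrite /off_edge aqv (eq_sym q) (negPf neq) /=.
by apply: contraTN aqv => /andP[/eqP-> _]; rewrite adj_irr.
Qed.

(** Two adjacent vertices on one level could both climb to the root without using their common edge,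
    which is a bridge. *)
Lemma adj_level_neq x y : adj T x y -> level x != level y.
Proof.
move=> xy; apply/eqP => lxy; apply: (negP (edge_bridge xy)).
have H v : level v = level x -> connect (off_edge x y) r v.
  move=> lv; have [->//|/parent_exists[p pv]] := eqVneq v r.
  have lp : level p < level x by rewrite -lv (parent_level pv).
  apply: (@connect_trans _ _ p); first by rewrite off_level // -lxy.
  apply: connect1; rewrite /off_edge; have /andP[-> _] /= := pv.
  have /negPf -> : p != x by apply: contraTneq lp => ->; rewrite ltnn.
  have /negPf -> // : p != y by apply: contraTneq lp => ->; rewrite lxy ltnn.
apply: (@connect_trans _ _ r); last exact: H.
by rewrite off_sym H.
Qed.

Lemma adj_parent x y : adj T x y -> parent_of x y || parent_of y x.
Proof.
move=> xy; have yx : adj T y x by rewrite adj_sym.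
rewrite /Defs.parent_of /= xy yx /=; have := adj_level_neq xy.
by rewrite neq_ltn => /orP[] lt; apply/orP; [left|right];
  rewrite eqn_leq level_adj.
Qed.

(** * Leaves, ancestors and lowest common ancestors *)

Lemma leafP v : reflect (forall w, ~~ parent_of v w) (leaf v).
Proof. exact: forallP. Qed.

Lemma adj_leaf p w : leaf w -> adj T p w = parent_of p w.
Proof.
move=> /leafP lw; apply/idP/andP => [|[]//] pw; apply/andP.
by have := adj_parent pw; rewrite (negPf (lw p)) orbF.
Qed.

Lemma ancestor_parent a v : ancestor a v = (a == v) ||
  [exists p, parent_of p v && ancestor a p].
Proof.
apply/idP/orP => [/connectP[p]|[/eqP->|/existsP[p /andP[pv ap]]]].
- case/lastP: p => [_ ->|p w]; first by left.
  rewrite rcons_path last_rcons => /andP[ap pw] ->; right; apply/existsP.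
  by exists (last a p); rewrite pw /=; apply/connectP; exists p.
- exact: connect0.
- by apply: connect_trans ap (connect1 _).
Qed.

Lemma ancestor_child a p v : parent_of p v ->
  ancestor a v = (a == v) || ancestor a p.
Proof.
move=> pv; rewrite ancestor_parent; congr (_ || _); apply/existsP/idP.
  by move=> [q /andP[/(parent_uniq pv) -> //]].
by move=> ap; exists p; rewrite pv.
Qed.

Lemma ancestor_level a v : ancestor a v -> a != v -> level a < level v.
Proof.
have [k] := ubnP (level v); elim: k v => // k IHk v.
rewrite ltnS ancestor_parent => lvk /orP[/eqP->|]; first by rewrite eqxx.
move=> /existsP[p /andP[pv ap]] _; have lp := parent_level pv.
have [->|neq] := eqVneq a p; first by rewrite lp.
by rewrite lp ltnW // ltnS IHk // -ltnS -lp ltnS.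
Qed.

Lemma ancestor_root v : ancestor r v.
Proof.
have [k] := ubnP (level v); elim: k v => // k IHk v; rewrite ltnS => lvk.
have [->|/parent_exists[p pv]] := eqVneq v r; first exact: connect0.
by rewrite (ancestor_child _ pv) IHk ?orbT // -(parent_level pv).
Qed.

(** By uniqueness of parents the ancestors of [v] form a chain; the induction replaces [v] by its
    parent. *)
Lemma ancestor_chain a b v : ancestor a v -> ancestor b v ->
  level a <= level b -> ancestor a b.
Proof.
have [k] := ubnP (level v); elim: k v => // k IHk v; rewrite ltnS => lvk.
rewrite [ancestor b v]ancestor_parent.
move=> av /orP[/eqP->//|/existsP[p /andP[pv bp]]] lab.
(* If [a] is [v] itself, then [b], lying at or above the parent [p], has too small a level. *)
move: av; rewrite (ancestor_child _ pv) => /orP[/eqP av|ap].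
  have lp := parent_level pv.
  have : level b <= level p.
    by have [->//|/(ancestor_level bp)/ltnW] := eqVneq b p.
  by rewrite leqNgt -lp -av lab.
by apply: (IHk p) => //; rewrite -(parent_level pv).
Qed.

(** Passing from a parent to its child adds exactly the child to the set of ancestors and one to the
    level. *)
Lemma card_ancestors v : #|[set a | (a != r) && ancestor a v]| = level v.
Proof.
have [k] := ubnP (level v); elim: k v => // k IHk v; rewrite ltnS => lvk.
have [->|vr] := eqVneq v r.
  rewrite level_root; apply: eq_card0 => a; rewrite inE.
  apply/andP=> -[ar] /ancestor_level/(_ ar).
  by rewrite level_root.
have [p pv] := parent_exists vr.
have lp := parent_level pv.
rewrite lp -(IHk p) -?lp //.
rewrite (_ : [set a | _] = v |: [set a | (a != r) && ancestor a p]).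
  rewrite cardsU1 inE (_ : _ && _ = false) //; apply/negP => /andP[_ vp].
  have /(ancestor_level vp) : v != p.
    by apply: contra_eq_neq lp => ->; rewrite neq_ltn leqnn.
  by rewrite lp ltnNge leqnSn.
apply/setP=> a; rewrite !inE (ancestor_child _ pv) andb_orr.
by congr (_ || _); apply/andP/idP => [[]//|/eqP->].
Qed.

(** By [ancestor_chain] the common ancestors of [v] and [w] are exactly the ancestors of
    [lca T v w]. This count is what exhibits the ancestral matrix as a Gram matrix. *)
Lemma level_lca v w :
  level (lca T v w) = #|[set a | [&& a != r, ancestor a v & ancestor a w]]|.
Proof.
rewrite /lca; case: arg_maxnP => [|m /andP[mv mw] max_m].
  by rewrite !ancestor_root.
rewrite -card_ancestors; apply: eq_card => a; rewrite !inE.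
congr (_ && _); apply/idP/andP => [am|[av aw]].
  by split; apply: connect_trans am _.
have lam : level a <= level m by apply: max_m; rewrite av.
exact: ancestor_chain av mv lam.
Qed.

Lemma leaf_ancestor a v : leaf a -> ancestor a v = (a == v).
Proof.
move=> la; apply/connectP/eqP => [[[|w p] /= + ->//]|->]; last by exists [::].
by rewrite (negPf (leafP _ la w)).
Qed.

Lemma nontrivial_leaf_neq_root w :
  (exists v, v != r) -> leaf w -> w != r.
Proof.
move=> [v vr] lw; apply: contra_neq vr => wr; apply/esym/eqP.
by rewrite -leaf_ancestor -wr // wr ancestor_root.
Qed.

Lemma ancestor_parent_leaf a p w : ~~ leaf a -> leaf w -> parent_of p w ->
  ancestor a w = ancestor a p.
Proof.
move=> la lw pw; rewrite (ancestor_child _ pw).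
by have [aw|//] := eqVneq a w; rewrite aw lw in la.
Qed.

(** * Leaf children and sibling classes *)

Definition leaf_children (p : V) : {set V} := [set w | leaf w && parent_of p w].

Lemma leaf_children_inj p q w :
  w \in leaf_children p -> w \in leaf_children q -> p = q.
Proof. by rewrite !inE => /andP[_ pw] /andP[_ /(parent_uniq pw)]. Qed.

Definition leaf_parents : {set V} := [set p | leaf_children p != set0].

Lemma leaf_parentsP p w : leaf w -> parent_of p w -> p \in leaf_parents.
Proof.
by move=> lw pw; rewrite inE; apply/set0Pn; exists w; rewrite inE lw.
Qed.

Lemma nonroot_adj_leafE : nonroot_adj_leaf T = leaf_parents :\ r.
Proof.
apply/setP=> p; rewrite !inE; congr (_ && _).
apply/existsP/set0Pn => -[w]; rewrite ?inE.
  by move=> /andP[lw pw]; exists w; rewrite inE lw -adj_leaf.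
by move=> /andP[lw pw]; exists w; rewrite lw adj_leaf.
Qed.

Lemma share_parent_children p : share_parent T (leaf_children p).
Proof.
apply/andP; split; first by apply/subsetP=> w; rewrite !inE => /andP[].
by apply/existsP; exists p; apply/forall_inP => w; rewrite inE => /andP[].
Qed.

Lemma share_parentP B : share_parent T B -> exists p, B \subset leaf_children p.
Proof.
move=> /andP[/subsetP lB /existsP[p /forall_inP pB]]; exists p.
by apply/subsetP=> w wB; have := lB _ wB; rewrite !inE => ->; exact: pB.
Qed.

Lemma leaf_parent_exists w : (exists v, v != r) -> leaf w ->
  exists2 p, p \in leaf_parents & parent_of p w.
Proof.
move=> nt lw; have [p pw] := parent_exists (nontrivial_leaf_neq_root nt lw).
by exists p => //; apply: leaf_parentsP pw.
Qed.

(** A vertex of maximal level is a leaf, and its parent is the required vertex. *)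
Lemma leaf_parents_neq0 : (exists v, v != r) -> leaf_parents != set0.
Proof.
move=> nt; have [w _ maxw] := @arg_maxnP _ r xpredT level isT.
have lw : leaf w.
  apply/leafP => x; apply/negP => wx.
  by have := maxw x isT; rewrite /= (parent_level wx) ltnn.
by have [p pP _] := leaf_parent_exists nt lw; apply/set0Pn; exists p.
Qed.

Lemma sibling_classesE : (exists v, v != r) ->
  sibling_classes T = leaf_children @: leaf_parents.
Proof.
move=> /leaf_parents_neq0/set0Pn[p0 p0P]; apply/setP=> B; rewrite inE.
apply/maxsetP/imsetP => [[/share_parentP[p Bp] maxB]|[p pP ->]].
  have Be := maxB _ (share_parent_children p) Bp; exists p => //.
  (* Were [leaf_children p] empty, maximality of [B] would make [leaf_children p0] empty as well. *)
  rewrite inE; apply/negP => /eqP p0'.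
  move: p0P; rewrite inE => /negP; apply; apply/eqP.
  rewrite -p0' Be; apply: maxB (share_parent_children p0) _.
  by rewrite -Be p0' sub0set.
split=> [|B' /share_parentP[q B'q] pB']; first exact: share_parent_children.
move: pP; rewrite inE => /set0Pn[w wp].
have wq := subsetP B'q _ (subsetP pB' _ wp).
by apply/eqP; rewrite eqEsubset pB' (leaf_children_inj wp wq) B'q.
Qed.

(** Every leaf has exactly one parent, so the sets of leaf children partition the leaves. *)
Lemma sum_leaf_children : (exists v, v != r) ->
  \sum_(p in leaf_parents) #|leaf_children p| = #|leaves T|.
Proof.
move=> nt; rewrite -sum1_card; under eq_bigr do rewrite -sum1_card.
rewrite (exchange_big_dep [in leaves T]) /=; last first.
  by move=> p w _; rewrite !inE => /andP[].
apply: eq_bigr => w; rewrite inE => lw.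
have [p pP pw] := leaf_parent_exists nt lw.
rewrite (bigD1 p) /=; last by rewrite pP inE lw.
rewrite big1 ?addn0 // => q /andP[/andP[_ qw]] /eqP[].
by apply: (leaf_children_inj (w := w)) => //; rewrite inE lw.
Qed.

End RootedTree.

(** * Diagonal ranks and multiplicities for normal matrices *)

Local Open Scope ring_scope.

(** Above, the rows lie in the span of the unit vectors indexed by [S]; below, the principal
    submatrix on [S] is invertible. *)
Lemma rank_diag_mx (F : fieldType) n (d : 'rV[F]_n) :
  \rank (diag_mx d) = #|[set i | d 0 i != 0]|.
Proof.
set S := [set i | _]; pose f (k : 'I_#|S|) := enum_val k.
have f_inj : injective f := @enum_val_inj _ _.
apply/eqP; rewrite eqn_leq; apply/andP; split.
  apply: leq_trans (rank_leq_row (rowsub f (1%:M : 'M[F]_n))).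
  apply/mxrankS/row_subP => i; rewrite row_diag_mx.
  have [->|di] := eqVneq (d 0 i) 0; first by rewrite scale0r sub0mx.
  have iS : i \in S by rewrite inE.
  apply/scalemx_sub; rewrite -row1 -[in row i _](enum_rankK_in iS iS) //.
  by rewrite -/(f _) -row_rowsub row_sub.
have <- : \rank (mxsub f f (diag_mx d)) = #|S|.
  have -> : mxsub f f (diag_mx d) = diag_mx (\row_k d 0 (f k)).
    by apply/matrixP => i j; rewrite !mxE (inj_eq f_inj).
  apply: mxrank_unit; rewrite unitmxE det_diag unitfE.
  apply/prodf_neq0 => k _; rewrite mxE.
  by have := enum_valP k; rewrite inE.
rewrite mxsubrc; apply: leq_trans (mxrankS (rowsub_sub _ _)) _.
by rewrite -mxrank_tr trmx_mxsub -[leqRHS]mxrank_tr mxrankS ?rowsub_sub.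
Qed.

(** Divisibility by a power of ['X - a%:P] is unchanged by a field extension. *)
Lemma mup_map (F K : fieldType) (f : {rmorphism F -> K}) a (p : {poly F}) :
  p != 0 -> mup (f a) (map_poly f p) = mup a p.
Proof.
move=> p0; have fp0 : map_poly f p != 0 by rewrite map_poly_eq0.
have H k : (k <= mup (f a) (map_poly f p))%N = (k <= mup a p)%N.
  rewrite !mup_geq // -(dvdp_map f) rmorphXn /= rmorphB /=.
  by rewrite map_polyX map_polyC.
by apply/eqP; rewrite eqn_leq -H leqnn H leqnn.
Qed.

Lemma char_poly_conj (F : fieldType) n (P D : 'M[F]_n) : P \in unitmx ->
  char_poly (invmx P *m D *m P) = char_poly D.
Proof.
move=> Pu; rewrite /char_poly; set Q := map_mx polyC P.
set Q' := map_mx polyC (invmx P).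
have QQ : Q' *m Q = 1%:M by rewrite -map_mxM mulVmx // map_mx1.
have -> : char_poly_mx (invmx P *m D *m P) = Q' *m char_poly_mx D *m Q.
  rewrite /char_poly_mx mulmxBr mulmxBl !map_mxM; congr (_ - _).
  by rewrite mul_mx_scalar -scalemxAl QQ scalemx1.
by rewrite !det_mulmx mulrAC -det_mulmx QQ det1 mul1r.
Qed.

(** After unitary diagonalization both sides count the diagonal entries equal to [a]. *)
Lemma mup_char_poly_normal (C : numClosedFieldType) n (A : 'M[C]_n) (a : C) :
  A \is normalmx -> mup a (char_poly A) = (n - \rank (A - a%:M)%R)%N.
Proof.
move=> /orthomx_spectralP; set P := spectralmx A; set d := spectral_diag A.
move=> eA; have Pu : P \in unitmx by exact/unitarymx_unit/spectral_unitarymx.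
have conjD (e : 'rV[C]_n) c : (invmx P *m diag_mx e *m P) - c%:M =
    invmx P *m diag_mx (e - const_mx c) *m P.
  rewrite linearB /= mulmxBr mulmxBl diag_const_mx; congr (_ - _).
  by rewrite mul_mx_scalar -scalemxAl mulVmx // scalemx1.
have -> : char_poly A = \prod_(y <- [seq d 0 i | i <- enum 'I_n]) ('X - y%:P).
  rewrite eA char_poly_conj // char_poly_trig ?diag_mx_is_trig //.
  rewrite big_map big_enum.
  by apply: eq_bigr => i _; rewrite mxE eqxx.
rewrite eA conjD mxrankMfree ?row_free_unit //.
rewrite -mxrank_tr trmx_mul.
rewrite mxrankMfree ?row_free_unit ?unitmx_tr ?unitmx_inv //.
rewrite mxrank_tr rank_diag_mx mu_prod_XsubC count_map.
rewrite (_ : count _ _ = #|[set i | d 0 i == a]|); last first.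
  by rewrite cardsE cardE -size_filter !enumT.
rewrite -[X in (X - _)%N](card_ord n) -(cardsC [set i | d 0 i == a]).
rewrite (_ : ~: _ = [set i | (d - const_mx a) 0 i != 0]) ?addnK //.
by apply/setP=> i; rewrite !inE !mxE subr_eq0.
Qed.

(** * The ancestral matrix as identity plus Gram matrix *)

Section AncestralMatrix.
Context (V : finType) (T : rooted_tree V).
Context (T_nontrivial : exists v : V, v != troot T).
Context n (l : 'I_n -> V) (l_leaves : leaf_ordering T l).
Local Notation r := (troot T).

Lemma leaf_nth i : leaf T (l i).
Proof. by have [_ /(_ (l i))] := l_leaves; rewrite codom_f inE. Qed.

Lemma card_leaves : #|leaves T| = n.
Proof.
have [l_inj /eq_card <-] := l_leaves.
by rewrite card_codom // card_ord.
Qed.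

(** This is the identity plus N N^T, entry by entry: a leaf is an ancestor of itself only, so the
    leaves among the common ancestors contribute the identity. *)
Lemma ancestral_mx_entry (K : nzRingType) i j : ancestral_mx T K l i j =
  (i == j)%:R + \sum_(a | (a != r) && ~~ leaf T a)
     (ancestor T a (l i))%:R * (ancestor T a (l j))%:R.
Proof.
have [l_inj _] := l_leaves.
have -> : ancestral_mx T K l i j =
    \sum_(a | a != r) (ancestor T a (l i))%:R * (ancestor T a (l j))%:R.
  rewrite mxE level_lca -sum1_card natr_sum big_mkcond [RHS]big_mkcond /=.
  apply: eq_bigr => a _; rewrite inE; case: (a != r) => //=.
  by do 2 case: (ancestor _ _ _); rewrite ?(mulr1, mulr0, mul0r).
rewrite (bigID (leaf T)) /=; congr (_ + _).
have lr := nontrivial_leaf_neq_root T_nontrivial (leaf_nth i).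
rewrite (bigD1 (l i)) /= ?lr ?leaf_nth // big1 ?addr0.
  by rewrite !leaf_ancestor ?leaf_nth // eqxx mul1r (inj_eq l_inj).
move=> a /andP[/andP[_ la] ai].
by rewrite leaf_ancestor // (negPf ai) mul0r.
Qed.

(** The coordinate of N^T x at [a]. *)
Definition descendant_sum (K : nzRingType) (a : V) (x : 'I_n -> K) : K :=
  \sum_(i | ancestor T a (l i)) x i.

Lemma ancestral_action (K : comNzRingType) (x : 'I_n -> K) i :
  \sum_j ancestral_mx T K l i j * x j =
  x i + \sum_(a | (a != r) && ~~ leaf T a)
    (ancestor T a (l i))%:R * descendant_sum a x.
Proof.
under eq_bigr do rewrite ancestral_mx_entry mulrDl mulr_suml.
rewrite big_split /= (bigD1 i) //= eqxx mul1r big1 ?addr0; last first.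
  by move=> j; rewrite eq_sym => /negPf ->; rewrite mul0r.
rewrite exchange_big; congr (_ + _); apply: eq_bigr => a _.
rewrite /descendant_sum big_distrr /= big_mkcond [RHS]big_mkcond /=.
rewrite [RHS]big_mkcond /=; apply: eq_bigr => j _.
by case: (ancestor T a (l j)); rewrite ?(mulr1, mulr0, mul0r).
Qed.

(** Taking for [y] the conjugate of [x] yields the eigenvalue bound, and taking [x] itself yields
    the eigenspace of 1. *)
Lemma ancestral_form (K : comNzRingType) (x y : 'I_n -> K) :
  \sum_i y i * (\sum_j ancestral_mx T K l i j * x j) =
  \sum_i y i * x i + \sum_(a | (a != r) && ~~ leaf T a)
    descendant_sum a y * descendant_sum a x.
Proof.
under eq_bigr do rewrite ancestral_action mulrDr mulr_sumr.
rewrite big_split exchange_big /=; congr (_ + _); apply: eq_bigr => a _.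
rewrite [X in _ = X * _]/descendant_sum big_distrl /= [RHS]big_mkcond /=.
apply: eq_bigr => i _.
by case: (ancestor T a (l i)); rewrite ?(mul1r, mulr0, mul0r).
Qed.

Lemma ancestral_mx_sym (K : nzRingType) :
  (ancestral_mx T K l)^T = ancestral_mx T K l.
Proof.
apply/matrixP=> i j; rewrite !mxE !level_lca; congr (_%:R).
by apply: eq_card => a; rewrite !inE [X in _ && X]andbC.
Qed.

Lemma ancestral_eigenvalue_ge1 (C : numClosedFieldType) (lambda : C) :
  eigenvalue (ancestral_mx T C l) lambda -> 1 <= lambda.
Proof.
case/eigenvalueP=> v vA v0; pose x i := v 0 i.
(* [eigenvalue] speaks of row vectors; symmetry of the matrix turns this into the action on
   columns. *)
have act i : \sum_j ancestral_mx T C l i j * x j = lambda * x i.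
  have /rowP/(_ i) := vA; rewrite !mxE => <-; apply: eq_bigr => j _.
  by rewrite mulrC -{1}ancestral_mx_sym mxE.
have := ancestral_form x (fun i => (x i)^*).
under eq_bigr do rewrite act mulrCA.
rewrite -mulr_sumr; set N := \sum_i _; set Q := \sum_(a | _) _ => eN.
have Q_ge0 : 0 <= Q.
  apply: sumr_ge0 => a _; rewrite /descendant_sum -rmorph_sum /= mulrC.
  exact: mul_conjC_ge0.
have [i vi] : exists i, v 0 i != 0 by apply/rV0Pn.
have N_gt0 : 0 < N.
  rewrite /N (bigD1 i) //= ltr_wpDr //; last by rewrite mulrC mul_conjC_gt0.
  by apply: sumr_ge0 => j _; rewrite mulrC mul_conjC_ge0.
by rewrite -(ler_pM2r N_gt0) mul1r eN lerDl.
Qed.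

(** For a fixed vector, [ancestral_form] with [y] equal to [x] leaves a vanishing sum of squares,
    and over an ordered field each square is then zero. *)
Lemma ancestral_kernel (K : realFieldType) (x : 'I_n -> K) :
  (forall i, \sum_j ancestral_mx T K l i j * x j = x i) <->
  (forall a, a != r -> ~~ leaf T a -> descendant_sum a x = 0).
Proof.
split=> [fix_x|S0 i]; last first.
  rewrite ancestral_action big1 ?addr0 // => a /andP[ar la].
  by rewrite S0 ?mulr0.
have := ancestral_form x x; under eq_bigr do rewrite fix_x.
rewrite -[LHS]addr0 => /addrI/esym/eqP; rewrite psumr_eq0 => [|a _]; last first.
  by rewrite -expr2 sqr_ge0.
move=> /allP S0 a ar la; apply/eqP.
by have := S0 a (mem_index_enum a); rewrite ar la /= mulf_eq0 orbb.
Qed.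

(** * Reduction to sums over leaf children *)

Definition sibling_sum (K : nzRingType) (p : V) (x : 'I_n -> K) : K :=
  \sum_(i | parent_of T p (l i)) x i.

(** Leaves are grouped by their parents: since [a] is not a leaf, it lies above a leaf exactly when
    it lies above the parent of that leaf. *)
Lemma descendant_sum_split (K : nzRingType) a (x : 'I_n -> K) : ~~ leaf T a ->
  descendant_sum a x = \sum_(p | ancestor T a p) sibling_sum p x.
Proof.
move=> la; rewrite /sibling_sum.
rewrite (exchange_big_dep (fun i => ancestor T a (l i))) /=; last first.
  by move=> p i ap pi; rewrite (ancestor_parent_leaf la (leaf_nth i) pi).
apply: eq_bigr => i ai.
have [p _ pi] := leaf_parent_exists T_nontrivial (leaf_nth i).
rewrite (bigD1 p) /=; last first.
  by rewrite pi -(ancestor_parent_leaf la (leaf_nth i) pi) ai.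
rewrite big1 ?addr0 // => q /andP[/andP[_ qi]] /eqP[].
exact: parent_uniq qi pi.
Qed.

(* The sums over descendants are triangular in the sums over leaf children,
   so the converse goes by induction from the deepest vertices upwards. *)
Lemma sibling_kernel (K : nzRingType) (x : 'I_n -> K) :
  (forall a, a != r -> ~~ leaf T a -> descendant_sum a x = 0) <->
  (forall p, p != r -> sibling_sum p x = 0).
Proof.
split=> [S0 p|D0 a ar la]; last first.
  rewrite descendant_sum_split // big1 // => p ap; apply: D0.
  apply: contraNneq ar => pr; rewrite pr in ap.
  rewrite -level_eq0; have [->|/(ancestor_level ap)] := eqVneq a r.
    by rewrite level_root.
  by rewrite level_root.
have [k] := ubnP (#|V| - level T p); elim: k p => // k IHk p.
rewrite ltnS => pk pr.
have [lp|lp] := boolP (leaf T p).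
  rewrite /sibling_sum big1 // => i pi.
  by have := leafP _ _ lp (l i); rewrite pi.
have := S0 p pr lp; rewrite descendant_sum_split // (bigD1 p) /=;
  last exact: connect0.
rewrite big1 ?addr0 // => q /andP[pq qp].
have lt : (level T p < level T q)%N by rewrite ancestor_level // eq_sym.
apply: IHk; last by rewrite -level_eq0 -lt0n (leq_ltn_trans _ lt).
apply: leq_trans pk; rewrite ltn_sub2l // (leq_trans lt) //.
by rewrite -card_ancestors max_card.
Qed.

Lemma ancestral_fixE (K : realFieldType) (x : 'cV[K]_n) :
  ((ancestral_mx T K l - 1%:M) *m x = 0) <->
  (forall p, p != r -> sibling_sum p (fun i => x i 0) = 0).
Proof.
rewrite -sibling_kernel -ancestral_kernel mulmxBl mul1mx.
split=> [/eqP|fix_x].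
  rewrite subr_eq0 => /eqP/colP fix_x i; rewrite -[RHS]fix_x mxE.
  by apply: eq_bigr.
by apply/colP=> i; rewrite !mxE -[x i 0]fix_x subrr.
Qed.

Lemma sibling_sum_leaf_parent (K : nzRingType) p (x : 'I_n -> K) :
  p \notin leaf_parents T -> sibling_sum p x = 0.
Proof.
move=> pP; rewrite /sibling_sum big1 // => i pi.
by rewrite (leaf_parentsP (leaf_nth i) pi) in pP.
Qed.

Lemma card_nonroot_adj_leaf_le : (#|nonroot_adj_leaf T| <= n)%N.
Proof.
rewrite -card_leaves -(sum_leaf_children T_nontrivial) nonroot_adj_leafE.
apply: leq_trans (subset_leq_card (subD1set _ _)) _.
rewrite -sum1_card leq_sum // => p; rewrite inE => pP.
by rewrite card_gt0.
Qed.

(** Coefficient matrix of the reduced system; only vertices with a leaf child get a row, the other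
    equations being trivial. *)
Definition sibling_mx (K : nzRingType) : 'M[K]_(#|nonroot_adj_leaf T|, n) :=
  \matrix_(k, i) (parent_of T (enum_val k) (l i))%:R.

Lemma sibling_mxE (K : realFieldType) (x : 'cV[K]_n) :
  ((ancestral_mx T K l - 1%:M) *m x = 0) <-> (sibling_mx K *m x = 0).
Proof.
rewrite ancestral_fixE.
have E k : (sibling_mx K *m x) k 0 =
    sibling_sum (enum_val k) (fun i => x i 0).
  rewrite mxE /sibling_sum big_mkcond [RHS]big_mkcond /=.
  by apply: eq_bigr => i _; rewrite mxE; case: ifP => _; rewrite ?mul1r ?mul0r.
split=> [D0|/colP G0 p pr].
  apply/colP=> k; rewrite E mxE D0 //.
  by have := enum_valP k; rewrite inE => /andP[].
have [pP|] := boolP (p \in leaf_parents T); last exact: sibling_sum_leaf_parent.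
have pA : p \in nonroot_adj_leaf T by rewrite nonroot_adj_leafE in_setD1 pr.
by have := G0 (enum_rank_in pA p); rewrite E enum_rankK_in // mxE.
Qed.

(** The rows are nonzero with disjoint supports, so selecting one leaf child for each row gives a
    right inverse. *)
Lemma sibling_mx_free (K : fieldType) : row_free (sibling_mx K).
Proof.
have wit (k : 'I_#|nonroot_adj_leaf T|) :
    exists i, parent_of T (enum_val k) (l i).
  have := enum_valP k; rewrite inE => /andP[_ /existsP[w /andP[lw pw]]].
  have [_ /(_ w)] := l_leaves; rewrite inE lw => /codomP[i wi].
  by exists i; rewrite -wi -adj_leaf.
apply/row_freeP; exists (\matrix_(i, k) (i == xchoose (wit k))%:R).
apply/matrixP=> k k'; rewrite !mxE (bigD1 (xchoose (wit k'))) //= !mxE eqxx.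
rewrite mulr1 big1 ?addr0 => [|i /negPf ne]; last by rewrite !mxE ne mulr0.
congr (_%:R); congr nat_of_bool; apply/idP/eqP => [pk|->]; last first.
  exact: (xchooseP (wit k')).
apply: enum_val_inj; apply: parent_uniq pk _.
exact: (xchooseP (wit k')).
Qed.

(** * Rank and algebraic multiplicity *)

Lemma ancestral_rank (K : realFieldType) :
  \rank (ancestral_mx T K l - 1%:M) = #|nonroot_adj_leaf T|.
Proof.
(* [kermx] is a left kernel, so [sibling_mxE] is applied to transposes, using that the ancestral
   matrix is symmetric. *)
have e : (kermx (ancestral_mx T K l - 1%:M) == kermx (sibling_mx K)^T)%MS.
  apply/andP; split; apply/rV_subP => u /sub_kermxP u0; apply/sub_kermxP.
    apply: trmx_inj; rewrite trmx_mul trmxK trmx0; apply/sibling_mxE.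
    apply: trmx_inj; rewrite trmx_mul trmxK trmx0 linearB /= trmx1.
    by rewrite ancestral_mx_sym.
  apply: trmx_inj; rewrite trmx_mul trmx0 linearB /= trmx1 ancestral_mx_sym.
  apply/sibling_mxE; apply: trmx_inj.
  by rewrite trmx_mul trmxK trmx0.
have := eqmx_rank e; rewrite !mxrank_ker mxrank_tr.
have /eqP -> := sibling_mx_free K.
(* Both ranks are at most [n], so they can be recovered from the truncated differences. *)
move=> en; have le1 := rank_leq_row (ancestral_mx T K l - 1%:M).
by rewrite -(subKn le1) en subKn // card_nonroot_adj_leaf_le.
Qed.

Lemma ancestral_normal (C : numClosedFieldType) :
  ancestral_mx T C l \is normalmx.
Proof.
apply/normalmxP; rewrite ancestral_mx_sym.
suff -> : map_mx Num.conj (ancestral_mx T C l) = ancestral_mx T C l by [].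
by apply/matrixP=> i j; rewrite !mxE rmorph_nat.
Qed.

(** The spectral theorem is applied over [R[i]]; multiplicity and rank are both unchanged by the
    extension from [R]. *)
Lemma ancestral_mult1 (R : rcfType) :
  mup 1 (char_poly (ancestral_mx T R l)) = (n - #|nonroot_adj_leaf T|)%N.
Proof.
rewrite -(mup_map (real_complex R)) ?monic_neq0 ?char_poly_monic //.
rewrite map_char_poly rmorph1.
have -> : map_mx (real_complex R) (ancestral_mx T R l) =
    ancestral_mx T R[i]%C l.
  by apply/matrixP=> i j; rewrite !mxE rmorph_nat.
rewrite mup_char_poly_normal ?ancestral_normal //.
rewrite (_ : _ - _ = map_mx (real_complex R) (ancestral_mx T R l - 1%:M)).
  by rewrite mxrank_map ancestral_rank.
apply/matrixP=> i j; rewrite !mxE rmorphB /= !rmorph_nat; congr (_ - _).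
Qed.

End AncestralMatrix.

(** * The basis of the eigenspace of 1 *)

Section EigenspaceOfOne.
Context (V : finType) (T : rooted_tree V).
Context (T_nontrivial : exists v : V, v != troot T).
Context n (l : 'I_n -> V) (l_leaves : leaf_ordering T l).
Local Notation r := (troot T).
Context (K : realFieldType).
Local Notation eigenspace1 :=
  (passmx.leigenspace (uT := 'cV[K]_n) (linfun (mulmx (ancestral_mx T K l))) 1).

Lemma mem_eigenspace1 (x : 'cV[K]_n) :
  x \in eigenspace1 <-> (ancestral_mx T K l - 1%:M) *m x = 0.
Proof.
rewrite memv_ker add_lfunE opp_lfunE scale_lfunE id_lfunE lfunE /=.
rewrite scale1r mulmxBl mul1mx.
by split=> /eqP.
Qed.

(** By rank-nullity, a system of [#|nonroot_adj_leaf T|] equations in [n] unknowns has at least this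
    many independent solutions. *)
Lemma eigenspace1_dim_ge : (n - #|nonroot_adj_leaf T| <= \dim eigenspace1)%N.
Proof.
pose g : 'Hom('cV[K]_n, 'cV[K]_#|nonroot_adj_leaf T|) :=
  linfun (mulmx (sibling_mx T l K)).
have -> : eigenspace1 = (fullv :&: lker g)%VS.
  apply/vspaceP => x; rewrite capfv [RHS]memv_ker lfunE /=.
  by apply/idP/eqP => [/mem_eigenspace1|]
    /(sibling_mxE T_nontrivial l_leaves) // /mem_eigenspace1.
have dim_cV m : \dim (fullv : {vspace 'cV[K]_m}) = m.
  by rewrite dimvf dim_matrix; apply: muln1.
rewrite leq_subLR addnC -[leqLHS]dim_cV -(limg_ker_dim g) leq_add2l.
by apply: leq_trans (dimvS (subvf _)) _; rewrite dim_cV.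
Qed.

Context (h : {set V} -> V) (ou : option V).
Context (h_choice : class_choice T h) (ou_choice : root_leaf_choice T ou).
Local Notation X := (eigenvectors1 T K l h ou).

Lemma class_head p : p \in leaf_parents T ->
  h (leaf_children T p) \in leaf_children T p.
Proof.
move=> pP; apply: h_choice; rewrite sibling_classesE //.
exact: imset_f.
Qed.

(** Each class gives one vector fewer than it has leaves; a chosen root leaf makes up for the class
    below the root, which [nonroot_adj_leaf] does not count. *)
Lemma size_eigenvectors1 : (size X <= n - #|nonroot_adj_leaf T|)%N.
Proof.
have n_sum : n = (\sum_(p in leaf_parents T) (#|leaf_children T p|.-1)
                 + #|leaf_parents T|)%N.
  rewrite -(card_leaves l_leaves) -(sum_leaf_children T_nontrivial).
  rewrite -sum1_card -big_split /=; apply: eq_bigr => p.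
  by rewrite inE -card_gt0 addn1 => /prednK.
rewrite size_cat size_allpairs_dep sumnE !big_map big_enum /=.
rewrite sibling_classesE // big_imset /=; last first.
  move=> p q pP qP epq; apply: (leaf_children_inj (class_head pP)).
  by rewrite epq class_head.
under eq_bigr => p pP.
  rewrite -cardE (_ : #|_| = #|leaf_children T p|.-1); first over.
  by rewrite [in RHS](cardsD1 (h (leaf_children T p))) class_head.
rewrite [in leqRHS]n_sum nonroot_adj_leafE [#|leaf_parents T|](cardsD1 r).
rewrite addnA addnK leq_add2l.
case: ou ou_choice => [u /andP[lu]|] //.
by rewrite adj_leaf // => ru; rewrite (leaf_parentsP lu ru).
Qed.

Lemma span_head_diff p w : leaf T w -> parent_of T p w ->
  leaf_vec K l (h (leaf_children T p)) - leaf_vec K l w \in <<X>>%VS.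
Proof.
move=> lw pw; have pP := leaf_parentsP lw pw.
have [->|wh] := eqVneq w (h (leaf_children T p)); first by rewrite subrr mem0v.
apply: memv_span; rewrite mem_cat; apply/orP; left.
apply/allpairsPdep; exists (leaf_children T p), w; split=> //.
  by rewrite mem_enum sibling_classesE ?imset_f.
by rewrite mem_enum !inE wh lw.
Qed.

Lemma span_root_head : r \in leaf_parents T ->
  leaf_vec K l (h (leaf_children T r)) \in <<X>>%VS.
Proof.
rewrite inE => /set0Pn[w]; rewrite inE => /andP[lw rw].
case: ou ou_choice (span_head_diff) => [u /andP[lu ru]|].
  rewrite adj_leaf // in ru => /(_ r u lu ru) hu.
  (* The chosen leaf [u] may differ from the head of its class; their difference is in the span
     too. *)
  rewrite -(subrK (leaf_vec K l u) (leaf_vec K l _)) memvD //.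
  by apply: memv_span; rewrite mem_cat mem_seq1 eqxx orbT.
move=> /forallP/(_ w); rewrite lw /= adj_leaf // rw.
by [].
Qed.

(** Each leaf vector is the head vector of its class minus a spanned difference. Collecting the
    heads gives [sibling_sum p x] as coefficient, which vanishes except possibly at the root. *)
Lemma eigenspace1_span : (eigenspace1 <= <<X>>)%VS.
Proof.
apply/subvP => x /mem_eigenspace1.
move=> /(ancestral_fixE T_nontrivial l_leaves) D0.
have -> : x = \sum_i x i 0 *: leaf_vec K l (l i).
  have [l_inj _] := l_leaves.
  apply/colP=> j; rewrite summxE (bigD1 j) //= !mxE eqxx mulr1 big1 ?addr0 //.
  by move=> i ij; rewrite !mxE (inj_eq l_inj) eq_sym (negPf ij) mulr0.
pose e p := leaf_vec K l (h (leaf_children T p)).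
rewrite (eq_bigr (fun i => \sum_(p | parent_of T p (l i))
   (x i 0 *: e p - x i 0 *: (e p - leaf_vec K l (l i))))) => [|i _]; last first.
  have [p _ pi] := leaf_parent_exists T_nontrivial (leaf_nth l_leaves i).
  rewrite (big_pred1 p) => [|q]; first by rewrite -scalerBr subKr.
  by apply/idP/eqP => [/parent_uniq/(_ pi)|->].
under eq_bigr do rewrite sumrB.
rewrite sumrB rpredB //; last first.
  apply: rpred_sum => i _; apply: rpred_sum => p pi; apply: rpredZ.
  exact: span_head_diff (leaf_nth l_leaves i) pi.
rewrite (exchange_big_dep xpredT) //=; apply: rpred_sum => p _.
rewrite -scaler_suml; have [->|pr] := eqVneq p r; last first.
  by rewrite [X in X *: _]D0 // scale0r mem0v.
have [rP|rP] := boolP (r \in leaf_parents T); first exact/rpredZ/span_root_head.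
by rewrite [X in X *: _](sibling_sum_leaf_parent l_leaves _ rP) scale0r mem0v.
Qed.

Lemma eigenvectors1_basis : basis_of eigenspace1 X.
Proof.
(* A family spanning at least the space, with no more vectors than its dimension, is a basis of
   it. *)
rewrite basisEdim eigenspace1_span.
exact: leq_trans size_eigenvectors1 eigenspace1_dim_ge.
Qed.

End EigenspaceOfOne.

Local Open Scope complex_scope.

Unset Implicit Arguments.
Theorem theorem2p1 (R : rcfType) (V : finType) (T : rooted_tree V)
    (T_nontrivial : exists v : V, v != troot T)
    (n : nat) (l : 'I_n -> V) (l_leaves : leaf_ordering T l) :
  [/\ forall lambda : R[i],
        eigenvalue (ancestral_mx T R[i] l) lambda -> 1 <= lambda,
      (mup 1 (char_poly (ancestral_mx T R l)))%:Z
        = #|leaves T|%:Z - #|nonroot_adj_leaf T|%:Z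
    & forall (h : {set V} -> V) (ou : option V),
        class_choice T h -> root_leaf_choice T ou ->
        basis_of (passmx.leigenspace (linfun (mulmx (ancestral_mx T R l))) 1)
                 (eigenvectors1 T R l h ou)].
Proof.
split=> [lambda|| h ou h_choice ou_choice].
- exact: ancestral_eigenvalue_ge1.
- rewrite ancestral_mult1 // (card_leaves l_leaves) subzn //.
  exact (card_nonroot_adj_leaf_le T_nontrivial l_leaves).
- exact (eigenvectors1_basis T_nontrivial l_leaves R h_choice ou_choice).
Qed.
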